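(* (Composition-Diamond lemma for $L$-algebras) Let $k$ be a field, $X$ a well-ordered set, $L(X)$ the free $L$-algebra over $k$ generated by $X$, with $k$-basis the set $N$ of normal words, and let $>$ be the ordering on $N$ described in the context. Let $S\subset L(X)$ be a set of monic polynomials and $Id(S)$ the ideal of $L(X)$ generated by $S$. Then the following statements are equivalent: (I) $S$ is a Gröbner-Shirshov basis in $L(X)$. (II) For every nonzero $f\in Id(S)$, $\overline f=u|_{\overline s}$ for some $s\in S$ and some normal $s$-word $u|_s$. (III) The set $Irr(S)=\{u\in N\mid u\neq v|_{\overline s}\text{ for all } s\in S\text{ and all normal } s\text{-words } v|_s\}$ is a $k$-basis of the $L$-algebra $L(X|S)=L(X)/Id(S)$.
   Context: An $L$-algebra over $k$ is a $k$-space with two bilinear operations $\prec,\succ$ satisfying $(x\succ y)\prec z=x\succ(y\prec z)$; ideals are two-sided with respect to both operations. Let $\Omega=\{\prec,\succ\}$. $(X,\Omega)$ (the $\Omega$-words) is the smallest set of formal expressions containing $X$ and closed under $u,v\mapsto u\prec v$, $u\succ v$. Normal words: $x\in X$; $v\succ w$ with $v,w$ normal; $v\prec w$ with $v,w$ normal and $v$ not of the form $v_1\succ v_2$. $N$ is the set of normal words. The free $L$-algebra is $L(X)=kN$ with $k$-basis $N$ and operations given for $u,v\in N$ by $u\succ v=[u\succ v]$ and $u\prec v=[u\prec v]$, where $[u\succ v]$ is the word $u\succ v$, $[u\prec v]$ is the word $u\prec v$ if $u\in X$ or $u=u_1\prec u_2$, and $[u\prec v]=u_1\succ[u_2\prec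 v]$ if $u=u_1\succ u_2$. Ordering: $|u|$ is the number of occurrences of elements of $X$ in $u$; $\delta_1$ denotes $\succ$, $\delta_2$ denotes $\prec$, $\delta_1<\delta_2$. Put $wt(x)=(1,x)$ for $x\in X$ and $wt(\delta_i(u_1,u_2))=(|u|,\delta_i,u_1,u_2)$ for $u=\delta_i(u_1,u_2)$; $u>v$ iff $wt(u)>wt(v)$ lexicographically, recursively on $|u|+|v|$. For $0\ne f\in L(X)$, $\overline f$ is the largest normal word occurring in $f$; $f$ is monic if its coefficient is $1$. A $\star$-$\Omega$-word is an element of $(X\cup\{\star\},\Omega)$ ($\star\notin X$) with exactly one occurrence of $\star$. For a $\star$-$\Omega$-word $u$ and $s\in L(X)$, the $s$-word $u|_s$ is the element of $L(X)$ obtained by substituting $s$ for $\star$ and evaluating in $L(X)$. It is a normal $s$-word if the $\Omega$-word $u|_{\overline s}$ (formal substitution) lies in $N$. Compositions for monic $f,g\in L(X)$: (1) right multiplication: if $\overline f=u_1\succ u_2$ with $u_1,u_2\in N$, then for any $v\in N$, $f\prec v$ is a composition of right multiplication. (2) inclusion: if $w=\overline f=u|_{\overline g}$ where $u|_g$ is a normal $g$-word, then $(f,g)_w=f-u|_g$ is a composition of inclusion. For a monic set $S$ and $f,g\in S$: $f\prec v$ is trivial modulo $S$ if $f\prec v=\sum\alpha_iu_i|_{s_i}$ (finite sum) with $\alpha_i\in k$, $s_i\in S$, $u_i|_{s_i}$ normal $s_i$-words and $u_i|_{\overline{s_i}}\le\overline{f\prec v}$; $(f,g)_w$ is trivial modulo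 $(S,w)$ if $(f,g)_w=\sum\alpha_iu_i|_{s_i}$ with $\alpha_i\in k$, $s_i\in S$, $u_i|_{s_i}$ normal $s_i$-words and $u_i|_{\overline{s_i}}<w$. $S$ is a Gröbner-Shirshov basis in $L(X)$ if all compositions of elements of $S$ are trivial. *)

(* Defs.v *)
From HB Require Import structures.
From mathcomp Require Import all_boot all_order all_algebra.
From mathcomp Require Import ring_quotient finmap boolp.
From mathcomp Require Import monalg.

Set Implicit Arguments.
Unset Strict Implicit.
Unset Printing Implicit Defensive.

Import Order.TTheory GRing.Theory.
Local Open Scope ring_scope.

Reserved Notation "x ≺ y" (at level 40, left associativity).
Reserved Notation "x ≻ y" (at level 40, left associativity).

(* L-algebras; not to be confused with MathComp's [lalgType] (rings over which
   scalars associate on the left). *)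
HB.mixin Record Lmodule_isEllAlgebra (k : nzRingType) V of GRing.Lmodule k V := {
  lprec : V -> V -> V;
  lsucc : V -> V -> V;
  lprec_linearl : forall y, linear (lprec^~ y);
  lprec_linearr : forall x, linear (lprec x);
  lsucc_linearl : forall y, linear (lsucc^~ y);
  lsucc_linearr : forall x, linear (lsucc x);
  lprec_lsucc : forall x y z, lprec (lsucc x y) z = lsucc x (lprec y z)
}.

#[short(type="ellAlgType")]
HB.structure Definition EllAlgebra (k : nzRingType) :=
  {V of GRing.Lmodule k V & Lmodule_isEllAlgebra k V}.

Notation "x ≺ y" := (lprec x y) : ring_scope.
Notation "x ≻ y" := (lsucc x y) : ring_scope.

Section Ideals.
Variables (k : nzRingType) (V : ellAlgType k).

Definition is_ideal (I : V -> Prop) : Prop :=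
  [/\ I 0,
      forall a x y, I x -> I y -> I (a *: x + y),
      forall x y, I x -> I (x ≺ y) /\ I (y ≺ x)
    & forall x y, I x -> I (x ≻ y) /\ I (y ≻ x)].

Definition Id (S : V -> Prop) (x : V) : Prop :=
  forall I : V -> Prop, is_ideal I -> (forall s, S s -> I s) -> I x.

Lemma Id_is_ideal S : is_ideal (Id S).
Proof.
split; first by move=> I [].
- move=> a x y Sx Sy I idI SI; have [_ lin _ _] := idI.
  by apply: lin; [apply: Sx | apply: Sy].
- move=> x y Sx; split=> I idI SI; have [_ _ h _] := idI;
    by case: (h x y (Sx I idI SI)).
- move=> x y Sx; split=> I idI SI; have [_ _ _ h] := idI;
    by case: (h x y (Sx I idI SI)).
Qed.

(* Boolean version of [Id S], as required by MathComp's quotients. *)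
Definition Idb (S : V -> Prop) : V -> bool := fun x => `[< Id S x >].

Fact Idb_zmod_closed S : zmod_closed (Idb S).
Proof.
have [I0 Ilin _ _] := Id_is_ideal S.
split=> [|x y /asboolP Ix /asboolP Iy]; apply/asboolP => //.
by rewrite addrC -scaleN1r; apply: Ilin.
Qed.

HB.instance Definition _ S := GRing.isZmodClosed.Build V (Idb S) (Idb_zmod_closed S).

Definition ell_quot (S : V -> Prop) : Type :=
  @Quotient.quot V (GRing.ZmodClosed.clone V (Idb S) _).

End Ideals.

Section QuotientEllAlgebra.
Variables (k : nzRingType) (V : ellAlgType k) (S : V -> Prop).
Local Notation Q := (ell_quot S).
Local Notation Q0 := (@Quotient.quot V (GRing.ZmodClosed.clone V (Idb S) _)).

HB.instance Definition _ := GRing.Zmodule.on Q.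
HB.instance Definition _ := EqQuotient.on Q.

Definition ell_pi (x : V) : Q := \pi_Q%qT x.

Lemma ell_pi_eq x y : ell_pi x = ell_pi y <-> Id S (x - y).
Proof.
split=> [|Ixy].
  move/eqP; rewrite /ell_pi -[_ == _]/(\pi_(Q0)%qT x == _).
  by rewrite -Quotient.idealrBE => /asboolP.
apply/eqP; rewrite -[_ == _]/(\pi_(Q0)%qT x == \pi_(Q0)%qT y).
by rewrite -Quotient.idealrBE; apply/asboolP.
Qed.

Lemma ell_piB x y : ell_pi (x - y) = ell_pi x - ell_pi y.
Proof. exact: (raddfB (\pi_(Q0)%qT)). Qed.
Lemma ell_piD x y : ell_pi (x + y) = ell_pi x + ell_pi y.
Proof. exact: (raddfD (\pi_(Q0)%qT)). Qed.

Definition ell_repr (x : Q) : V := repr (x : Q0).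
Lemma ell_reprK x : ell_pi (ell_repr x) = x.
Proof. exact: reprK. Qed.
Lemma ell_pi_repr x : Id S (ell_repr (ell_pi x) - x).
Proof. by apply/ell_pi_eq; rewrite ell_reprK. Qed.

Definition ell_quot_scale (a : k) (x : Q) : Q := ell_pi (a *: ell_repr x).
Definition ell_quot_prec (x y : Q) : Q := ell_pi (ell_repr x ≺ ell_repr y).
Definition ell_quot_succ (x y : Q) : Q := ell_pi (ell_repr x ≻ ell_repr y).

Lemma ell_piZ a x : ell_quot_scale a (ell_pi x) = ell_pi (a *: x).
Proof.
apply/ell_pi_eq; rewrite -scalerBr -[_ *: _]addr0.
by have [I0 Ilin _ _] := Id_is_ideal S; apply: Ilin => //; apply: ell_pi_repr.
Qed.

Lemma Id_congr2 (op : V -> V -> V) :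
    (forall y, linear (op^~ y)) -> (forall x, linear (op x)) ->
    (forall x y, Id S x -> Id S (op x y) /\ Id S (op y x)) ->
  forall x y x' y', Id S (x' - x) -> Id S (y' - y) -> Id S (op x' y' - op x y).
Proof.
move=> linl linr idl x y x' y' Ix Iy.
have [I0 Ilin _ _] := Id_is_ideal S.
have -> : op x' y' - op x y = 1 *: op (x' - x) y' + op x (y' - y).
  have -> : op (x' - x) y' = op x' y' - op x y'.
    by rewrite -scaleN1r addrC linl scaleN1r addrC.
  have -> : op x (y' - y) = op x y' - op x y.
    by rewrite -scaleN1r addrC linr scaleN1r addrC.
  by rewrite scale1r addrA subrK.
by apply: Ilin; [case: (idl (x' - x) y') | case: (idl (y' - y) x)].
Qed.

Lemma ell_pi_prec x y : ell_quot_prec (ell_pi x) (ell_pi y) = ell_pi (x ≺ y).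
Proof.
have [_ _ Ip _] := Id_is_ideal S.
by apply/ell_pi_eq; apply: (Id_congr2 (op := lprec)) => //;
  [exact: lprec_linearl | exact: lprec_linearr
  | exact: ell_pi_repr | exact: ell_pi_repr].
Qed.

Lemma ell_pi_succ x y : ell_quot_succ (ell_pi x) (ell_pi y) = ell_pi (x ≻ y).
Proof.
have [_ _ _ Ip] := Id_is_ideal S.
by apply/ell_pi_eq; apply: (Id_congr2 (op := lsucc)) => //;
  [exact: lsucc_linearl | exact: lsucc_linearr
  | exact: ell_pi_repr | exact: ell_pi_repr].
Qed.

Fact ell_quot_scaleA a b x :
  ell_quot_scale a (ell_quot_scale b x) = ell_quot_scale (a * b) x.
Proof. by rewrite -[x]ell_reprK !ell_piZ scalerA. Qed.
Fact ell_quot_scale1 : left_id 1 ell_quot_scale.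
Proof. by move=> x; rewrite -[x]ell_reprK !ell_piZ scale1r. Qed.
Fact ell_quot_scaleDr : right_distributive ell_quot_scale +%R.
Proof.
move=> a x y; rewrite -[x]ell_reprK -[y]ell_reprK -ell_piD !ell_piZ.
by rewrite scalerDr ell_piD.
Qed.
Fact ell_quot_scaleDl x : {morph ell_quot_scale^~ x : a b / a + b}.
Proof.
by move=> a b /=; rewrite -[x]ell_reprK !ell_piZ scalerDl ell_piD.
Qed.

HB.instance Definition _ := GRing.Zmodule_isLmodule.Build k Q
  ell_quot_scaleA ell_quot_scale1 ell_quot_scaleDr ell_quot_scaleDl.

Fact ell_pi_is_linear : linear ell_pi.
Proof. by move=> a x y; rewrite ell_piD -ell_piZ. Qed.
HB.instance Definition _ :=
  GRing.isLinear.Build k V Q *:%R ell_pi ell_pi_is_linear.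

Fact ell_quot_prec_linearl y : linear (ell_quot_prec^~ y).
Proof.
move=> a x x'; rewrite -[x]ell_reprK -[x']ell_reprK -[y]ell_reprK.
by rewrite -linearP !ell_pi_prec lprec_linearl linearP.
Qed.
Fact ell_quot_prec_linearr x : linear (ell_quot_prec x).
Proof.
move=> a y y'; rewrite -[x]ell_reprK -[y]ell_reprK -[y']ell_reprK.
by rewrite -linearP !ell_pi_prec lprec_linearr linearP.
Qed.
Fact ell_quot_succ_linearl y : linear (ell_quot_succ^~ y).
Proof.
move=> a x x'; rewrite -[x]ell_reprK -[x']ell_reprK -[y]ell_reprK.
by rewrite -linearP !ell_pi_succ lsucc_linearl linearP.
Qed.
Fact ell_quot_succ_linearr x : linear (ell_quot_succ x).
Proof.
move=> a y y'; rewrite -[x]ell_reprK -[y]ell_reprK -[y']ell_reprK.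
by rewrite -linearP !ell_pi_succ lsucc_linearr linearP.
Qed.
Fact ell_quot_prec_succ x y z :
  ell_quot_prec (ell_quot_succ x y) z = ell_quot_succ x (ell_quot_prec y z).
Proof.
rewrite -[x]ell_reprK -[y]ell_reprK -[z]ell_reprK.
by rewrite !(ell_pi_succ, ell_pi_prec) lprec_lsucc.
Qed.

HB.instance Definition _ := Lmodule_isEllAlgebra.Build k Q
  ell_quot_prec_linearl ell_quot_prec_linearr
  ell_quot_succ_linearl ell_quot_succ_linearr ell_quot_prec_succ.

End QuotientEllAlgebra.

(* The family (e t), for t satisfying P, is a basis of V; in particular
   e is injective on P if V is over a nonzero ring. *)
Definition is_basis_on (k : nzRingType) (V : lmodType k) (T : Type)
    (P : T -> Prop) (e : T -> V) : Prop :=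
  (forall (n : nat) (t : 'I_n -> T) (c : 'I_n -> k),
     injective t -> (forall i, P (t i)) ->
     \sum_(i < n) c i *: e (t i) = 0 -> forall i, c i = 0) /\
  (forall v : V, exists (n : nat) (t : 'I_n -> T) (c : 'I_n -> k),
     (forall i, P (t i)) /\ v = \sum_(i < n) c i *: e (t i)).

Inductive word (A : Type) : Type :=
| WVar of A
| WSucc of word A & word A
| WPrec of word A & word A.

Section WordChoice.
Variable A : choiceType.

Fixpoint word_encode (u : word A) : GenTree.tree A :=
  match u with
  | WVar x => GenTree.Leaf x
  | WSucc u1 u2 => GenTree.Node 0 [:: word_encode u1; word_encode u2]
  | WPrec u1 u2 => GenTree.Node 1 [:: word_encode u1; word_encode u2]
  end.

Fixpoint word_decode (t : GenTree.tree A) : option (word A) :=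
  match t with
  | GenTree.Leaf x => Some (WVar x)
  | GenTree.Node n [:: t1; t2] =>
      if (word_decode t1, word_decode t2) is (Some u1, Some u2)
      then Some (if n == 0%N then WSucc u1 u2 else WPrec u1 u2) else None
  | _ => None
  end.

Lemma word_encodeK : pcancel word_encode word_decode.
Proof. by elim=> //= u -> v ->. Qed.

HB.instance Definition _ := Choice.copy (word A) (pcan_type word_encodeK).

End WordChoice.

Section WordOps.
Variable A : Type.
Implicit Types u v : word A.

Fixpoint wsize u : nat :=
  match u with
  | WVar _ => 1
  | WSucc u1 u2 | WPrec u1 u2 => (wsize u1 + wsize u2)%N
  end.

Definition is_succ u : bool := if u is WSucc _ _ then true else false.

Fixpoint is_normal u : bool :=
  match u with
  | WVar _ => true
  | WSucc u1 u2 => is_normal u1 && is_normal u2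
  | WPrec u1 u2 => [&& is_normal u1, is_normal u2 & ~~ is_succ u1]
  end.

Fixpoint wprec u v : word A :=
  if u is WSucc u1 u2 then WSucc u1 (wprec u2 v) else WPrec u v.

Lemma wsize_gt0 u : (0 < wsize u)%N.
Proof. by elim: u => //= u1 h1 u2 h2; rewrite addn_gt0 h1. Qed.

Lemma is_normal_wprec u v : is_normal u -> is_normal v -> is_normal (wprec u v).
Proof.
move=> + nv; elim: u => [x|u1 _ u2 IH|u1 _ u2 _] //=; first by rewrite nv.
  by case/andP=> -> /IH.
by rewrite nv => ->.
Qed.

End WordOps.

Section WordOrder.
Variables (d : Order.disp_t) (X : orderType d).
Implicit Types u v w : word X.

(* Lexicographic comparison of the weights; a letter and a compound word
   never have the same length. *)
Fixpoint wlt u v : bool :=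
  (wsize u < wsize v)%N || (wsize u == wsize v) &&
  match u, v with
  | WVar x, WVar y => (x < y)%O
  | WSucc u1 u2, WSucc v1 v2 | WPrec u1 u2, WPrec v1 v2 =>
      wlt u1 v1 || (u1 == v1) && wlt u2 v2
  | WSucc _ _, WPrec _ _ => true
  | _, _ => false
  end.

Definition wle u v : bool := (u == v) || wlt u v.

Lemma wltE u v : wlt u v =
  (wsize u < wsize v)%N || (wsize u == wsize v) &&
  match u, v with
  | WVar x, WVar y => (x < y)%O
  | WSucc u1 u2, WSucc v1 v2 | WPrec u1 u2, WPrec v1 v2 =>
      wlt u1 v1 || (u1 == v1) && wlt u2 v2
  | WSucc _ _, WPrec _ _ => true
  | _, _ => false
  end.
Proof. by case: u. Qed.

Fact wlt_irr : irreflexive wlt.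
Proof.
by elim=> [x|u hu v hv|u hu v hv]; rewrite wltE ltnn eqxx /= ?ltxx ?hu ?hv ?andbF.
Qed.

Fact wlt_trans : transitive wlt.
Proof.
move=> v u; elim: u v => [x|u1 IH1 u2 IH2|u1 IH1 u2 IH2] v w;
  rewrite [wlt _ v]wltE [wlt v w]wltE [wlt _ w]wltE;
  (case/orP=> [uv|/andP[/eqP uv huv]]; case/orP=> [vw|/andP[/eqP vw hvw]];
   [by rewrite (ltn_trans uv vw) | by rewrite -vw uv | by rewrite uv vw |]);
  rewrite uv vw eqxx ltnn /=; move: {uv vw} huv hvw.
- by case: v => // y; case: w => // z; apply: lt_trans.
- case: v => // v1 v2; case: w => // w1 w2.
  case/orP=> [l1|/andP[/eqP-> l2]]; case/orP=> [m1|/andP[/eqP<- m2]].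
  + by rewrite (IH1 _ _ l1 m1).
  + by rewrite l1.
  + by rewrite m1.
  + by rewrite eqxx (IH2 _ _ l2 m2) orbT.
- case: v => // v1 v2; case: w => // w1 w2.
  case/orP=> [l1|/andP[/eqP-> l2]]; case/orP=> [m1|/andP[/eqP<- m2]].
  + by rewrite (IH1 _ _ l1 m1).
  + by rewrite l1.
  + by rewrite m1.
  + by rewrite eqxx (IH2 _ _ l2 m2) orbT.
Qed.

Fact wlt_total u v : u != v -> wlt u v || wlt v u.
Proof.
have eqSS u1 u2 v1 v2 :
  (WSucc u1 u2 == WSucc v1 v2 :> word X) = (u1 == v1) && (u2 == v2).
  by apply/eqP/andP=> [[-> ->]|[/eqP-> /eqP->]].
have eqPP u1 u2 v1 v2 :
  (WPrec u1 u2 == WPrec v1 v2 :> word X) = (u1 == v1) && (u2 == v2).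
  by apply/eqP/andP=> [[-> ->]|[/eqP-> /eqP->]].
have gt1 u1 u2 : (1 < wsize u1 + wsize u2)%N.
  by rewrite -(addn1 1) leq_add ?wsize_gt0.
elim: u v => [x|u1 IH1 u2 IH2|u1 IH1 u2 IH2] v neq;
  rewrite wltE [wlt v _]wltE; case: ltngtP => //= sz;
  case: v sz neq => [y|v1 v2|v1 v2] //= sz; try by have := gt1 v1 v2; rewrite -sz.
- by move=> neq; rewrite -neq_lt; apply: contraNneq neq => ->.
- by have := gt1 u1 u2; rewrite sz.
- rewrite eqSS; have [->|/IH1] := eqVneq u1 v1.
    by rewrite wlt_irr /=; apply: IH2.
  by case/orP=> ->; rewrite ?orbT.
- by have := gt1 u1 u2; rewrite sz.
- rewrite eqPP; have [->|/IH1] := eqVneq u1 v1.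
    by rewrite wlt_irr /=; apply: IH2.
  by case/orP=> ->; rewrite ?orbT.
Qed.

Fact word_display : Order.disp_t. Proof. exact: (Order.Disp tt tt). Qed.

HB.instance Definition _ := Order.LtOrder.Build word_display (word X)
  (fun _ _ => erefl) (fun _ _ => erefl) (fun _ _ => erefl)
  wlt_irr wlt_trans wlt_total.

End WordOrder.

Record nword (d : Order.disp_t) (X : orderType d) : Type :=
  NWord { nval :> word X; nwordP : is_normal nval }.

Section NormalWords.
Variables (d : Order.disp_t) (X : orderType d).

HB.instance Definition _ := [isSub for @nval d X].
HB.instance Definition _ := [Choice of nword X by <:].
HB.instance Definition _ := [SubChoice_isSubOrder of nword X by <: with word_display].

Definition nvar (x : X) : nword X := @NWord d X (WVar x) isT.

Definition nsucc (u v : nword X) : nword X :=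
  @NWord d X (WSucc u v) (introT andP (conj (nwordP u) (nwordP v))).

Definition nprec (u v : nword X) : nword X :=
  @NWord d X (wprec u v) (is_normal_wprec (nwordP u) (nwordP v)).

Lemma nprec_nsucc u v w : nprec (nsucc u v) w = nsucc u (nprec v w).
Proof. exact: val_inj. Qed.

End NormalWords.

Lemma malgZU (k : fieldType) (K : choiceType) (c a : k) (u : K) :
  c *: (<< a *g u >> : {malg k[K]}) = << c * a *g u >>.
Proof. by apply/malgP=> v; rewrite mcoeffZ !mcoeffU mulrnAr. Qed.

Section FreeEllAlgebra.
Variables (k : fieldType) (d : Order.disp_t) (X : orderType d).

Local Notation freeL := {malg k[nword X]}.

Definition bilin_ext (op : nword X -> nword X -> nword X) (f g : freeL) : freeL :=
  \sum_(u <- msupp f) \sum_(v <- msupp g) << f@_u * g@_v *g op u v >>.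

Lemma bilin_extEw op (f g : freeL) (D E : {fset nword X}) :
  (msupp f `<=` D)%fset -> (msupp g `<=` E)%fset ->
  bilin_ext op f g = \sum_(u <- D) \sum_(v <- E) << f@_u * g@_v *g op u v >>.
Proof.
move=> sD sE; rewrite /bilin_ext.
rewrite (big_fset_incl _ sD) => [|u _ /mcoeff_outdom->]; last first.
  by rewrite big1 // => v _; rewrite mul0r monalgU0.
apply: eq_bigr => u _; rewrite (big_fset_incl _ sE) // => v _ /mcoeff_outdom->.
by rewrite mulr0 monalgU0.
Qed.

Lemma bilin_ext_linearl op g : linear (bilin_ext op ^~ g).
Proof.
move=> a f f' /=.
set D := (msupp f `|` msupp f' `|` msupp (a *: f + f' : freeL))%fset.
have s1 : (msupp f `<=` D)%fset.
  by apply/fsubsetP=> u; rewrite !inE => ->.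
have s2 : (msupp f' `<=` D)%fset.
  by apply/fsubsetP=> u; rewrite !inE => ->; rewrite orbT.
have s3 : (msupp (a *: f + f' : freeL) `<=` D)%fset.
  by apply/fsubsetP=> u; rewrite !inE => ->; rewrite !orbT.
rewrite (bilin_extEw op s1 (fsubset_refl (msupp g))).
rewrite (bilin_extEw op s2 (fsubset_refl (msupp g))).
rewrite (bilin_extEw op s3 (fsubset_refl (msupp g))).
rewrite scaler_sumr -big_split; apply: eq_bigr => u _ /=.
rewrite scaler_sumr -big_split; apply: eq_bigr => v _ /=.
by rewrite mcoeffD mcoeffZ mulrDl -mulrA monalgUD malgZU.
Qed.

Lemma bilin_ext_linearr op f : linear (bilin_ext op f).
Proof.
move=> a g g' /=.
set D := (msupp g `|` msupp g' `|` msupp (a *: g + g' : freeL))%fset.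
have s1 : (msupp g `<=` D)%fset.
  by apply/fsubsetP=> u; rewrite !inE => ->.
have s2 : (msupp g' `<=` D)%fset.
  by apply/fsubsetP=> u; rewrite !inE => ->; rewrite orbT.
have s3 : (msupp (a *: g + g' : freeL) `<=` D)%fset.
  by apply/fsubsetP=> u; rewrite !inE => ->; rewrite !orbT.
rewrite (bilin_extEw op (fsubset_refl (msupp f)) s1).
rewrite (bilin_extEw op (fsubset_refl (msupp f)) s2).
rewrite (bilin_extEw op (fsubset_refl (msupp f)) s3).
rewrite scaler_sumr -big_split; apply: eq_bigr => u _ /=.
rewrite scaler_sumr -big_split; apply: eq_bigr => v _ /=.
by rewrite mcoeffD mcoeffZ mulrDr mulrCA monalgUD malgZU.
Qed.

Lemma bilin_extUU op u v (a b : k) :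
  bilin_ext op << a *g u >> << b *g v >> = << a * b *g op u v >>.
Proof.
rewrite (bilin_extEw op msuppU_le msuppU_le).
by rewrite !big_seq_fset1 !mcoeffUU.
Qed.

Lemma linear_malg_ind (f g : freeL -> freeL) :
  linear f -> linear g -> (forall u, f << u >> = g << u >>) -> f =1 g.
Proof.
move=> lf lg fg x.
pose F := HB.pack_for {linear freeL -> freeL} f (GRing.isLinear.Build k freeL freeL *:%R f lf).
pose G := HB.pack_for {linear freeL -> freeL} g (GRing.isLinear.Build k freeL freeL *:%R g lg).
rewrite -[f x]/(F x) -[g x]/(G x) (monalgE x) !linear_sum.
apply: eq_bigr => u _.
have -> : << x@_u *g u >> = x@_u *: (<< u >> : freeL) by rewrite malgZU mulr1.
by rewrite !linearZ; congr (_ *: _); apply: fg.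
Qed.

Fact free_prec_succ (x y z : freeL) :
  bilin_ext (@nprec d X) (bilin_ext (@nsucc d X) x y) z
  = bilin_ext (@nsucc d X) x (bilin_ext (@nprec d X) y z).
Proof.
have lin := (bilin_ext_linearl, bilin_ext_linearr).
apply: (linear_malg_ind (f := fun x => bilin_ext (@nprec d X) (bilin_ext (@nsucc d X) x y) z)
  (g := fun x => bilin_ext (@nsucc d X) x (bilin_ext (@nprec d X) y z)));
  [by move=> a f f'; rewrite !lin | by move=> a f f'; rewrite !lin | move=> u].
apply: (linear_malg_ind (f := fun y => bilin_ext (@nprec d X) (bilin_ext (@nsucc d X) _ y) z)
  (g := fun y => bilin_ext (@nsucc d X) _ (bilin_ext (@nprec d X) y z)));
  [by move=> a f f'; rewrite !lin | by move=> a f f'; rewrite !lin | move=> v].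
apply: (linear_malg_ind (f := fun z => bilin_ext (@nprec d X) (bilin_ext (@nsucc d X) _ _) z)
  (g := fun z => bilin_ext (@nsucc d X) _ (bilin_ext (@nprec d X) _ z)));
  [by move=> a f f'; rewrite !lin | by move=> a f f'; rewrite !lin | move=> w].
rewrite (bilin_extUU (@nsucc d X) u v) (bilin_extUU (@nprec d X) v w).
by rewrite (bilin_extUU (@nprec d X)) (bilin_extUU (@nsucc d X)) mulrA nprec_nsucc.
Qed.

HB.instance Definition _ := Lmodule_isEllAlgebra.Build k freeL
  (bilin_ext_linearl (@nprec d X)) (bilin_ext_linearr (@nprec d X))
  (bilin_ext_linearl (@nsucc d X)) (bilin_ext_linearr (@nsucc d X))
  free_prec_succ.

End FreeEllAlgebra.

Notation freeL k X := {malg k[nword X]}.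

Section GroebnerShirshov.
Variables (k : fieldType) (d : Order.disp_t) (X : orderType d).
Local Notation L := (freeL k X).
Local Notation N := (nword X).
Implicit Types (f g s : L) (S : L -> Prop).

Definition basis_elt (u : N) : L := << u >>.

(* [is_lead f w] says that f is nonzero with leading word w. *)
Definition is_lead f (w : N) : Prop :=
  w \in msupp f /\ (forall u : N, u \in msupp f -> (u <= w)%O).

Definition is_monic f : Prop := exists2 w : N, is_lead f w & f@_w = 1.

(* Words over X with an additional letter, [None] standing for the star. *)
Fixpoint star_count (u : word (option X)) : nat :=
  match u with
  | WVar None => 1
  | WVar (Some _) => 0
  | WSucc u1 u2 | WPrec u1 u2 => (star_count u1 + star_count u2)%N
  end.

Definition star_word (u : word (option X)) : Prop := star_count u = 1%N.

Fixpoint star_subst (u : word (option X)) (v : word X) : word X :=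
  match u with
  | WVar None => v
  | WVar (Some x) => WVar x
  | WSucc u1 u2 => WSucc (star_subst u1 v) (star_subst u2 v)
  | WPrec u1 u2 => WPrec (star_subst u1 v) (star_subst u2 v)
  end.

Fixpoint star_eval (u : word (option X)) (s : L) : L :=
  match u with
  | WVar None => s
  | WVar (Some x) => basis_elt (nvar x)
  | WSucc u1 u2 => star_eval u1 s ≻ star_eval u2 s
  | WPrec u1 u2 => star_eval u1 s ≺ star_eval u2 s
  end.

(* [normal_sword u s w]: u is a star-word, [star_eval u s] is a normal s-word,
   and w is the normal word obtained by formally substituting the leading word
   of s for the star in u. *)
Definition normal_sword (u : word (option X)) s (w : N) : Prop :=
  star_word u /\
  exists2 sbar : N, is_lead s sbar & star_subst u sbar = w :> word X.

(* h is a finite combination of normal s-words, s in S, whose words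
   obtained by substituting leading words all satisfy the bound B. *)
Definition trivial_below S (B : N -> Prop) (h : L) : Prop :=
  exists (n : nat) (a : 'I_n -> k) (u : 'I_n -> word (option X)) (s : 'I_n -> L),
    (forall i, S (s i) /\ exists2 w : N, normal_sword (u i) (s i) w & B w) /\
    h = \sum_(i < n) a i *: star_eval (u i) (s i).

Definition right_mult_trivial S : Prop :=
  forall f (fbar u1 u2 v : N), S f -> is_lead f fbar -> fbar = nsucc u1 u2 ->
  forall w : N, is_lead (f ≺ basis_elt v) w ->
  trivial_below S (fun w' => (w' <= w)%O) (f ≺ basis_elt v).

Definition inclusion_trivial S : Prop :=
  forall f g (u : word (option X)) (w : N), S f -> S g ->
  is_lead f w -> normal_sword u g w ->
  trivial_below S (fun w' => (w' < w)%O) (f - star_eval u g).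

Definition GS_basis S : Prop := right_mult_trivial S /\ inclusion_trivial S.

Definition Irr S (u : N) : Prop :=
  forall s (v : word (option X)), S s -> ~ normal_sword v s u.

End GroebnerShirshov.

(* Main.v *)
Require Import Defs.
From HB Require Import structures.
From mathcomp Require Import all_boot all_order all_algebra.
From mathcomp Require Import finmap monalg.

Set Implicit Arguments.
Unset Strict Implicit.
Unset Printing Implicit Defensive.

Import Order.TTheory GRing.Theory.
Local Open Scope ring_scope.

(** The order on normal words is a well-order, and in each argument the two
products of L(X) are strictly increasing on normal words
([nsucc_ltl], [nprec_ltl], and their mirror images).  Hence a normal s-word
u|_s is monic and its leading word is the formal substitution u|_sbar
([nsword_monic]): normal s-words are the reduction rules of a rewriting
system on N.

(I) => (II).  The span of the normal s-words is an ideal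
([nspan_is_ideal]).  The only product that can leave it is u|_s ≺ v: the
axiom (x ≻ y) ≺ z = x ≻ (y ≺ z) pushes v to the right through the outer ≻
signs, until either a normal s-word is formed or v meets s itself, whose
leading word is then a ≻-word; this is a composition of right
multiplication.  So every element of Id(S) is a combination of normal
s-words.  If the highest word w occurs for several of these s-words, all but
one can be traded for lower ones, because two normal s-words P, Q with the
same leading word differ by a combination of normal s-words below it
([nsword_uniq]): going down in the common word w, either one occurrence
contains the other, a composition of inclusion, or they split, and then with
P over p, Q over q and a product o one has
P o q - p o Q = (P - p) o Q - P o (Q - q), where P - p and Q - q involve only
words below p and q ([cross_nspan]).  After the trade, either w survives with
a nonzero coefficient, and is the leading word of the sum, or the bound has
dropped; well-foundedness concludes ([nspan_lead]).

(II) => (I).  A composition lies in Id(S); (II) allows the subtraction of a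
multiple of a normal s-word that cancels the leading word without leaving
Id(S), and the process ends ([leads_reducible_nspan]).

(II) <=> (III).  By the same reduction, every f
is congruent modulo Id(S) to a combination of irreducible words that obey
every downward closed bound on the words of f ([Irr_division]).  So Irr(S)
always spans the quotient, and its independence says that Id(S) contains no
nonzero combination of irreducible words.  That follows from (II), and gives
(II) back: if the leading word w of f in Id(S) were irreducible, replacing
the lower part of f by its irreducible form would give such a combination,
still led by w. *)

(** * The order on normal words *)

Section WordOrder.
Variables (d : Order.disp_t) (X : orderType d).
Implicit Types (u v w : word X) (p q : nword X).
Local Arguments wlt : simpl never.

Lemma wlt_wsize u v : wlt u v -> (wsize u <= wsize v)%N.
Proof. by rewrite wltE; case/orP=> [/ltnW|/andP[/eqP->]]. Qed.

Lemma wlt_WSuccl u u' v : wlt u u' -> wlt (WSucc u v) (WSucc u' v).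
Proof.
move=> uu'; rewrite wltE /= uu' andbT ltn_add2r eqn_add2r orbC -leq_eqVlt.
exact: wlt_wsize.
Qed.

Lemma wlt_WSuccr u v v' : wlt v v' -> wlt (WSucc u v) (WSucc u v').
Proof.
move=> vv'; rewrite wltE /= vv' eqxx orbT andbT ltn_add2l eqn_add2l orbC -leq_eqVlt.
exact: wlt_wsize.
Qed.

Lemma wlt_WPrecl u u' v : wlt u u' -> wlt (WPrec u v) (WPrec u' v).
Proof.
move=> uu'; rewrite wltE /= uu' andbT ltn_add2r eqn_add2r orbC -leq_eqVlt.
exact: wlt_wsize.
Qed.

Lemma wlt_WPrecr u v v' : wlt v v' -> wlt (WPrec u v) (WPrec u v').
Proof.
move=> vv'; rewrite wltE /= vv' eqxx orbT andbT ltn_add2l eqn_add2l orbC -leq_eqVlt.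
exact: wlt_wsize.
Qed.

Lemma wsize_wprec u v : wsize (wprec u v) = (wsize u + wsize v)%N.
Proof. by elim: u => //= u1 _ u2 ->; rewrite addnA. Qed.

(** Between compound words of equal length, [wprec] preserves the top
operations, hence their comparison. *)
Lemma wlt_wprecl u u' v : wlt u u' -> wlt (wprec u v) (wprec u' v).
Proof.
elim: u u' => [x|u1 _ u2 IH|u1 _ u2 _] u' uu'; have := uu';
  rewrite {1}wltE => /orP[lt_sz|/andP[/eqP eq_sz]];
  try by rewrite wltE !wsize_wprec ltn_add2r lt_sz.
- by case: u' uu' {eq_sz} => // y xy _; apply: wlt_WPrecl.
- case: u' uu' eq_sz => //= [u1' u2'|u1' u2'] uu' eq_sz.
    case/orP=> [lt1|/andP[/eqP-> /IH]]; last exact: wlt_WSuccr.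
    by rewrite wltE /= lt1 !wsize_wprec !addnA eq_sz eqxx orbT.
  by rewrite wltE /= wsize_wprec addnA eq_sz eqxx orbT.
- by case: u' uu' {eq_sz} => // u1' u2' uu' _; apply: wlt_WPrecl.
Qed.

Lemma wlt_wprecr u v v' : wlt v v' -> wlt (wprec u v) (wprec u v').
Proof.
move=> vv'; elim: u => [x|u1 _ u2 IH|u1 _ u2 _] /=.
- exact: wlt_WPrecr.
- exact: wlt_WSuccr.
- exact: wlt_WPrecr.
Qed.

Lemma nword_ltE p q : (p < q)%O = wlt p q.
Proof. by []. Qed.

Lemma nsucc_ltl q : {homo (@nsucc d X)^~ q : p p' / (p < p')%O}.
Proof. by move=> p p'; rewrite !nword_ltE; apply: wlt_WSuccl. Qed.
Lemma nsucc_ltr p : {homo nsucc p : q q' / (q < q')%O}.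
Proof. by move=> q q'; rewrite !nword_ltE; apply: wlt_WSuccr. Qed.
Lemma nprec_ltl q : {homo (@nprec d X)^~ q : p p' / (p < p')%O}.
Proof. by move=> p p'; rewrite !nword_ltE; apply: wlt_wprecl. Qed.
Lemma nprec_ltr p : {homo nprec p : q q' / (q < q')%O}.
Proof. by move=> q q'; rewrite !nword_ltE; apply: wlt_wprecr. Qed.

Lemma nsucc_inj p q p' q' : nsucc p q = nsucc p' q' -> p = p' /\ q = q'.
Proof. by case=> /val_inj-> /val_inj->. Qed.

Lemma nprecE p q : ~~ is_succ p -> nprec p q = WPrec p q :> word X.
Proof. by case: p => -[]. Qed.

Lemma nprec_inj p q p' q' : ~~ is_succ p -> ~~ is_succ p' ->
  nprec p q = nprec p' q' -> p = p' /\ q = q'.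
Proof.
move=> np np' /(congr1 (@nval d X)); rewrite !nprecE //.
by case=> /val_inj-> /val_inj->.
Qed.

Lemma nsucc_neq_nprec p q p' q' : ~~ is_succ p' -> nsucc p q <> nprec p' q'.
Proof. by move=> np' /(congr1 (@nval d X)); rewrite nprecE. Qed.

(** Induction along the outer ≻ signs, the ones through which [nprec]
recurses. *)
Lemma nword_ind (P : nword X -> Prop) :
  (forall p, ~~ is_succ p -> P p) ->
  (forall p q, P p -> P q -> P (nsucc p q)) -> forall p, P p.
Proof.
move=> Pn Ps [u]; elim: u => [x|u1 IH1 u2 IH2|u1 _ u2 _] nu; try exact: Pn.
have /andP[n1 n2] : is_normal u1 && is_normal u2 by [].
rewrite (_ : NWord nu = nsucc (NWord n1) (NWord n2)); last exact: val_inj.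
exact: Ps (IH1 n1) (IH2 n2).
Qed.

(** Strong induction on the length.  At a fixed length the components of a
word are shorter, hence accessible, so that the lexicographic comparison of
components is well founded; all ≻-words come before the ≺-words, and words of
length one compare as letters. *)
Lemma wlt_wf : well_founded (fun x y : X => (x < y)%O) ->
  well_founded (fun u v : word X => wlt u v).
Proof.
move=> X_wo.
suff acc n u : (wsize u < n)%N -> Acc (fun u v : word X => wlt u v) u.
  by move=> u; apply: (acc (wsize u).+1).
elim: n u => [u|n IHn u]; first by rewrite ltn0.
rewrite ltnS leq_eqVlt => /orP[/eqP|]; last exact: IHn.
have ltl u1 u2 : (wsize u1 + wsize u2)%N = n -> (wsize u1 < n)%N.
  by move=> <-; rewrite -[X in (X < _)%N]addn0 ltn_add2l wsize_gt0.
have ltr u1 u2 : (wsize u1 + wsize u2)%N = n -> (wsize u2 < n)%N.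
  by rewrite addnC; apply: ltl.
have accS u1 u2 : wsize (WSucc u1 u2) = n ->
    Acc (fun u v : word X => wlt u v) (WSucc u1 u2).
  move=> szu; have lt1 := ltl _ _ szu.
  elim: {lt1} u1 / (IHn _ lt1) u2 szu => u1 _ IH1 u2 szu.
  have lt2 := ltr _ _ szu.
  elim: {lt2} u2 / (IHn _ lt2) szu => u2 _ IH2 szu.
  constructor=> v; rewrite wltE szu => /orP[|/andP[/eqP]]; first exact: IHn.
  case: v => [x|v1 v2|v1 v2] szv; [discriminate| |discriminate].
  case/orP=> [/IH1|/andP[/eqP ev /IH2]]; first by apply.
  by rewrite ev in szv *; apply.
case: u => [x|u1 u2|u1 u2] szu; [|exact: accS|].
- elim: x / (X_wo x) szu => x _ IHx szu.
  constructor=> v; rewrite wltE szu => /orP[|/andP[/eqP]]; first exact: IHn.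
  case: v => [y|v1 v2|v1 v2] szv; [|discriminate|discriminate].
  by move=> /IHx; apply.
- have lt1 := ltl _ _ szu.
  elim: {lt1} u1 / (IHn _ lt1) u2 szu => u1 _ IH1 u2 szu.
  have lt2 := ltr _ _ szu.
  elim: {lt2} u2 / (IHn _ lt2) szu => u2 _ IH2 szu.
  constructor=> v; rewrite wltE szu => /orP[|/andP[/eqP]]; first exact: IHn.
  case: v => [x|v1 v2|v1 v2] szv; [discriminate|by move=> _; apply: accS|].
  case/orP=> [/IH1|/andP[/eqP ev /IH2]]; first by apply.
  by rewrite ev in szv *; apply.
Qed.

Lemma nword_wf : well_founded (fun x y : X => (x < y)%O) ->
  well_founded (fun p q : nword X => (p < q)%O).
Proof.
move=> /wlt_wf wf p; move: (wf p) (erefl (nval p)); move: {1 3}(nval p) => u accu.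
elim: {u} accu p => u _ IH p pu; constructor=> q qp; apply: (IH (nval q)) => //.
by rewrite -pu.
Qed.

End WordOrder.

(** * Linear spans *)

Section Span.
Variables (k : nzRingType) (V : lmodType k).

(** The inductive form makes induction on the number of summands available,
where finite families indexed by ordinals would need reindexing. *)
Inductive span (G : V -> Prop) : V -> Prop :=
| span0 : span G 0
| span_add a x y of G x & span G y : span G (a *: x + y).

Lemma span_gen (G : V -> Prop) x : G x -> span G x.
Proof.
by move=> Gx; rewrite -[x]scale1r -[_ *: _]addr0; apply/span_add/span0.
Qed.

Lemma span_lin G a x y : span G x -> span G y -> span G (a *: x + y).
Proof.
move=> sx sy; elim: sx => [|b z t Gz _ IH]; first by rewrite scaler0 add0r.
by rewrite scalerDr -addrA scalerA; apply: span_add.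
Qed.

Lemma spanD G x y : span G x -> span G y -> span G (x + y).
Proof. by rewrite -[x in x + _]scale1r; apply: span_lin. Qed.
Lemma spanZ G a x : span G x -> span G (a *: x).
Proof. by move=> sx; rewrite -[_ *: _]addr0; apply/span_lin/span0. Qed.
Lemma spanN G x : span G x -> span G (- x).
Proof. by rewrite -scaleN1r; apply: spanZ. Qed.
Lemma spanB G x y : span G x -> span G y -> span G (x - y).
Proof. by move=> sx sy; apply/spanD/spanN. Qed.

Lemma span_sum G n (a : 'I_n -> k) (x : 'I_n -> V) :
  (forall i, G (x i)) -> span G (\sum_(i < n) a i *: x i).
Proof.
move=> Gx; elim/big_rec: _ => [|i y _]; [exact: span0 | exact: span_add].
Qed.

End Span.

Lemma linear_sub (k : nzRingType) (V W : lmodType k) (F : V -> W) x y :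
  linear F -> F (x - y) = F x - F y.
Proof. by move=> linF; rewrite addrC -scaleN1r linF scaleN1r addrC. Qed.

Lemma span_linear (k : nzRingType) (V W : lmodType k) (F : V -> W)
    (G : V -> Prop) (Q : W -> Prop) :
  linear F -> (forall x, G x -> span Q (F x)) ->
  forall x, span G x -> span Q (F x).
Proof.
move=> linF GQ x; elim=> [|a y z Gy _ IH].
  by rewrite -[0](subrr 0) linear_sub // subrr; apply: span0.
by rewrite linF; apply: span_lin => //; apply: GQ.
Qed.

Lemma span_mono (k : nzRingType) (V : lmodType k) (G Q : V -> Prop) :
  (forall x, G x -> Q x) -> forall x, span G x -> span Q x.
Proof.
by move=> GQ; apply: (span_linear (F := id)) => // x /GQ; apply: span_gen.
Qed.

(** * Supports and leading words in the free algebra *)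

Section Support.
Variables (k : fieldType) (d : Order.disp_t) (X : orderType d).
Local Notation L := (freeL k X).
Local Notation N := (nword X).
Local Notation b := (basis_elt k).
Implicit Types (f g h P Q : L) (p q v w : N).

Definition supp_in (B : N -> Prop) f := forall v, v \in msupp f -> B v.

Lemma supp_in0 B : supp_in B 0.
Proof. by move=> v; rewrite msupp0. Qed.

Lemma supp_in_lin B a f g : supp_in B f -> supp_in B g -> supp_in B (a *: f + g).
Proof.
move=> Bf Bg v; rewrite -mcoeff_neq0 mcoeffD mcoeffZ.
have [/Bf //|/mcoeff_outdom->] := boolP (v \in msupp f).
have [/Bg //|/mcoeff_outdom->] := boolP (v \in msupp g).
by rewrite mulr0 addr0 eqxx.
Qed.

Lemma supp_in_basis (B : N -> Prop) p : B p -> supp_in B (b p).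
Proof. by move=> Bp v; rewrite msuppU oner_eq0 inE => /eqP->. Qed.

Lemma supp_in_mono (B C : N -> Prop) f :
  (forall v, B v -> C v) -> supp_in B f -> supp_in C f.
Proof. by move=> BC Bf v /Bf/BC. Qed.

Lemma mcoeff_supp_in (B : N -> Prop) f v : supp_in B f -> ~ B v -> f@_v = 0.
Proof. by move=> Bf nBv; apply/mcoeff_outdom/negP => /Bf. Qed.

Lemma malg_sumZ f : f = \sum_(v <- msupp f) f@_v *: b v.
Proof.
rewrite [LHS]monalgE; apply: eq_bigr => v _.
by rewrite /basis_elt malgZU mulr1.
Qed.

Lemma malg_sum_tnth f : let t := in_tuple (enum_fset (msupp f)) in
  f = \sum_(i < size (enum_fset (msupp f))) f@_(tnth t i) *: b (tnth t i).
Proof. by move=> t; rewrite [LHS]malg_sumZ [LHS]big_tnth; apply: eq_bigr. Qed.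

Lemma supp_in_span B f :
  supp_in B f -> span (fun x : L => exists2 v, B v & x = b v) f.
Proof.
move=> Bf; rewrite (malg_sumZ f) big_seq; elim/big_rec: _ => [|v x vf].
  exact: span0.
by apply: span_add; exists v => //; apply: Bf.
Qed.

Lemma span_supp_in B f : span (supp_in B) f -> supp_in B f.
Proof.
elim=> [|a x y Bx _ By]; [exact: supp_in0 | exact: supp_in_lin].
Qed.

Lemma supp_in_linear B (V : lmodType k) (F : L -> V) (Q : V -> Prop) :
  linear F -> (forall v, B v -> span Q (F (b v))) ->
  forall f, supp_in B f -> span Q (F f).
Proof.
move=> linF BQ f /supp_in_span; apply: span_linear => // x [v Bv ->].
exact: BQ.
Qed.

Lemma is_lead_uniq f w w' : is_lead f w -> is_lead f w' -> w = w'.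
Proof.
by move=> [wf lew] [w'f lew']; apply/le_anti; rewrite lew // lew'.
Qed.

Lemma is_lead_neq0 f w : is_lead f w -> f <> 0.
Proof. by move=> [wf _] f0; move: wf; rewrite f0 msupp0. Qed.

Lemma is_lead_exists f : f <> 0 -> exists w, is_lead f w.
Proof.
move=> f0; have {f0} : msupp f <> fset0 
  by move=> f_0; apply: f0; apply/malgP=> v; rewrite mcoeff0 mcoeff_outdom // f_0.
suff max (s : seq N) :
    s != [::] -> exists2 w, w \in s & {in s, forall v, (v <= w)%O}.
  move=> f0; have [|w ws lew] := max (enum_fset (msupp f)); last by exists w.
  apply: contra_notN f0 => /eqP s0; apply/fsetP=> v.
  by rewrite -[v \in _]/(v \in enum_fset _) s0.
elim: s => // x s IH _; case: (eqVneq s [::]) => [->|/IH[w ws lew]].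
  by exists x; rewrite ?inE // => v; rewrite inE => /eqP->.
exists (Order.max x w).
  by rewrite /Order.max; case: ifP; rewrite inE ?ws ?eqxx ?orbT.
by move=> v; rewrite inE le_max => /orP[/eqP->|/lew ->]; rewrite ?lexx ?orbT.
Qed.

(** Monic with leading word p, in the form P = p + lower words, to which
linear maps apply directly. *)
Definition monic_at P p := supp_in (fun v => (v < p)%O) (P - b p).

Lemma monic_at_basis p : monic_at (b p) p.
Proof. by move=> v; rewrite subrr msupp0. Qed.

Lemma monic_at_mcoeff P p : monic_at P p -> P@_p = 1.
Proof.
move=> /mcoeff_supp_in -/(_ p); rewrite ltxx mcoeffB mcoeffUU => h.
by apply/eqP; rewrite -subr_eq0 h.
Qed.

Lemma monic_at_le P p : monic_at P p -> supp_in (fun v => (v <= p)%O) P.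
Proof.
move=> mP; rewrite -[P](subrK (b p)) -[_ - _]scale1r; apply: supp_in_lin.
  by apply: supp_in_mono mP => v /ltW.
exact: supp_in_basis.
Qed.

Lemma monic_at_lead P p : monic_at P p -> is_lead P p.
Proof.
move=> mP; split; last exact: monic_at_le.
by rewrite -mcoeff_neq0 (monic_at_mcoeff mP) oner_neq0.
Qed.

(** One step of polynomial division. *)
Lemma lead_cancel f w P : supp_in (fun v => (v <= w)%O) f -> monic_at P w ->
  supp_in (fun v => (v < w)%O) (f - f@_w *: P).
Proof.
move=> lef mP v vf; rewrite lt_neqAle; apply/andP; split.
  apply: contraTneq vf => ->.
  by rewrite -mcoeff_eq0 mcoeffB mcoeffZ (monic_at_mcoeff mP) mulr1 subrr.
move: v vf; rewrite addrC -scaleNr; apply: supp_in_lin => //.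
exact: monic_at_le.
Qed.

Lemma is_monic_at f w : is_monic f -> is_lead f w -> monic_at f w.
Proof.
move=> [w' lw' fw'] lw; rewrite -(is_lead_uniq lw lw') in fw'.
by have := lead_cancel lw.2 (@monic_at_basis w); rewrite fw' scale1r.
Qed.

Lemma basis_succ p q : b p ≻ b q = b (nsucc p q).
Proof. by rewrite [LHS]bilin_extUU mulr1. Qed.
Lemma basis_prec p q : b p ≺ b q = b (nprec p q).
Proof. by rewrite [LHS]bilin_extUU mulr1. Qed.

(** Applied to the four maps that multiply by a fixed word on one side. *)
Lemma monic_at_linear (F : L -> L) (phi : N -> N) P p :
  linear F -> (forall v, F (b v) = b (phi v)) -> {homo phi : v w / (v < w)%O} ->
  monic_at P p -> monic_at (F P) (phi p).
Proof.
move=> linF Fb mono mP; rewrite /monic_at -Fb.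
rewrite -(linear_sub _ _ linF); apply: span_supp_in.
apply: (supp_in_linear linF _ mP) => v /mono lt_v; apply: span_gen.
by rewrite Fb; apply: supp_in_basis.
Qed.

End Support.

(** * Normal s-words, built by multiplication from outside *)

Section StarWords.
Variables (k : fieldType) (d : Order.disp_t) (X : orderType d).
Local Notation L := (freeL k X).
Local Notation N := (nword X).
Local Notation b := (basis_elt k).
Variable S : L -> Prop.
Implicit Types (f g h P Q s : L) (p q v w : N).

(** Normal s-words P = u|_s for s in S, with p = u|_sbar.  A star-word whose
substitution is normal is a path of one-sided products by normal words from
the star to the root; building it along that path gives the inductions of the
proof, without star-words.  The conditions on ≺ are the ones that keep the
word normal. *)
Inductive nsword : L -> N -> Prop :=
| nsword_gen s w of S s & is_lead s w : nsword s w
| nsword_succl P p v of nsword P p : nsword (P ≻ b v) (nsucc p v)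
| nsword_succr v P p of nsword P p : nsword (b v ≻ P) (nsucc v p)
| nsword_precl P p v of ~~ is_succ p & nsword P p : nsword (P ≺ b v) (nprec p v)
| nsword_precr v P p of ~~ is_succ v & nsword P p : nsword (b v ≺ P) (nprec v p).

Fixpoint starfree (u : word X) : word (option X) :=
  match u with
  | WVar x => WVar (Some x)
  | WSucc u1 u2 => WSucc (starfree u1) (starfree u2)
  | WPrec u1 u2 => WPrec (starfree u1) (starfree u2)
  end.

Lemma star_count_starfree u : star_count (starfree u) = 0%N.
Proof. by elim: u => //= u1 -> u2 ->. Qed.

Lemma star_subst_starfree u v : star_subst (starfree u) v = u.
Proof. by elim: u => //= u1 -> u2 ->. Qed.

(** The evaluation uses the products of the free algebra, which on words that
are not normal differ from the formal ones; they agree on every subword of a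
normal word. *)
Lemma star_eval_free (u : word (option X)) s (v : word X) p :
  star_count u = 0%N -> star_subst u v = p -> star_eval u s = b p.
Proof.
elim: u p => [[x|]|u1 IH1 u2 IH2|u1 IH1 u2 IH2] p.
- by move=> _ e; congr b; apply: val_inj.
- by move=> /= c; discriminate c.
- move=> /eqP; rewrite addn_eq0 => /andP[/eqP c1 /eqP c2] e.
  have := nwordP p; rewrite -e => /andP[n1 n2].
  rewrite /= (IH1 (NWord n1) c1 erefl) (IH2 (NWord n2) c2 erefl) basis_succ.
  by congr b; apply: val_inj.
- move=> /eqP; rewrite addn_eq0 => /andP[/eqP c1 /eqP c2] e.
  have := nwordP p; rewrite -e => /and3P[n1 n2 ns].
  rewrite /= (IH1 (NWord n1) c1 erefl) (IH2 (NWord n2) c2 erefl) basis_prec.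
  by congr b; apply: val_inj; apply: etrans e; apply: nprecE.
Qed.

Lemma star_eval_starfree p s : star_eval (starfree p) s = b p.
Proof.
exact: (star_eval_free _ (star_count_starfree p) (star_subst_starfree p p)).
Qed.

Lemma nsword_normal_sword P p : nsword P p ->
  exists s u, [/\ S s, normal_sword u s p & P = star_eval u s].
Proof.
elim=> {P p} [s w Ss ls|P p v _|v P p _|P p v np _|v P p nv _].
- by exists s, (WVar None); split=> //; split=> //; exists w.
- move=> [s [u [Ss [cu [w lw su]] ->]]]; exists s, (WSucc u (starfree v)).
  rewrite /= star_eval_starfree; split=> //; split.
    by rewrite /star_word /= cu star_count_starfree.
  by exists w; rewrite //= su star_subst_starfree.
- move=> [s [u [Ss [cu [w lw su]] ->]]]; exists s, (WSucc (starfree v) u).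
  rewrite /= star_eval_starfree; split=> //; split.
    by rewrite /star_word /= cu star_count_starfree.
  by exists w; rewrite //= su star_subst_starfree.
- move=> [s [u [Ss [cu [w lw su]] ->]]]; exists s, (WPrec u (starfree v)).
  rewrite /= star_eval_starfree; split=> //; split.
    by rewrite /star_word /= cu star_count_starfree.
  by exists w; rewrite //= su star_subst_starfree -nprecE.
- move=> [s [u [Ss [cu [w lw su]] ->]]]; exists s, (WPrec (starfree v) u).
  rewrite /= star_eval_starfree; split=> //; split.
    by rewrite /star_word /= cu star_count_starfree.
  by exists w; rewrite //= su star_subst_starfree -nprecE.
Qed.

Lemma normal_sword_nsword s u p :
  S s -> normal_sword u s p -> nsword (star_eval u s) p.
Proof.
move=> Ss [cu [w lw]].
elim: u p cu => [[x|]|u1 IH1 u2 IH2|u1 IH1 u2 IH2] p //.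
- by move=> _ e; rewrite -(val_inj e : w = p); apply: nsword_gen.
- move=> cu e; have := nwordP p; rewrite -e => /andP[n1 n2].
  rewrite (_ : p = nsucc (NWord n1) (NWord n2)); last exact: val_inj.
  have [c1|c1] : star_count u1 = 0%N \/ star_count u1 = 1%N.
    by move: cu; rewrite /star_word /=; case: star_count => [|[|?]] //; [left|right].
    rewrite /= (star_eval_free (p := NWord n1) s c1 erefl).
    by apply/nsword_succr/IH2 => //; move: cu; rewrite /star_word /= c1.
  have c2 : star_count u2 = 0%N by move: cu; rewrite /star_word /= c1 => -[].
  rewrite /= (star_eval_free (p := NWord n2) s c2 erefl).
  by apply/nsword_succl/IH1.
- move=> cu e; have := nwordP p; rewrite -e => /and3P[n1 n2 ns].
  rewrite (_ : p = nprec (NWord n1) (NWord n2)); last first.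
    by apply: val_inj; apply: etrans (esym e) (esym _); apply: nprecE.
  have [c1|c1] : star_count u1 = 0%N \/ star_count u1 = 1%N.
    by move: cu; rewrite /star_word /=; case: star_count => [|[|?]] //; [left|right].
    rewrite /= (star_eval_free (p := NWord n1) s c1 erefl).
    by apply/nsword_precr/IH2 => //; move: cu; rewrite /star_word /= c1.
  have c2 : star_count u2 = 0%N by move: cu; rewrite /star_word /= c1 => -[].
  rewrite /= (star_eval_free (p := NWord n2) s c2 erefl).
  by apply/nsword_precl/IH1.
Qed.

(** The inductive counterpart of [trivial_below]. *)
Definition nspan (B : N -> Prop) := span (fun P => exists2 p, nsword P p & B p).

Lemma trivial_belowP B h : trivial_below S B h <-> nspan B h.
Proof.
split=> [[n [a [u [s [h_us ->]]]]]|].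
  apply: span_sum => i; have [Ss [w nw Bw]] := h_us i.
  by exists w => //; apply: normal_sword_nsword.
elim=> [|a P y [p nP Bp] _ [n [a' [u' [s' [h_us ->]]]]]].
  have no (A : Type) (i : 'I_0) : A by case: i.
  exists 0%N, (no k), (no _), (no _); split; first by case.
  by rewrite big_ord0.
have [s [u [Ss nu ->]]] := nsword_normal_sword nP.
pose ext (A : Type) (x : A) (t : 'I_n -> A) (i : 'I_n.+1) :=
  oapp t x (unlift ord0 i).
exists n.+1, (ext _ a a'), (ext _ u u'), (ext _ s s'); split.
  move=> i; rewrite /ext; case: unliftP => [j|] _ /=; first exact: h_us.
  by split=> //; exists p.
rewrite big_ord_recl /ext unlift_none /=; apply: f_equal.
by apply: eq_bigr => i _; rewrite liftK.
Qed.

Lemma nspan_mono (B C : N -> Prop) h :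
  (forall p, B p -> C p) -> nspan B h -> nspan C h.
Proof.
by move=> BC; apply: span_mono => P [p nP Bp]; exists p => //; apply: BC.
Qed.

Lemma nsword_nspan (B : N -> Prop) P p : nsword P p -> B p -> nspan B P.
Proof. by move=> nP Bp; apply: span_gen; exists p. Qed.

Lemma nspan_linear (B C : N -> Prop) (F : L -> L) : linear F ->
  (forall P p, nsword P p -> B p -> nspan C (F P)) ->
  forall h, nspan B h -> nspan C (F h).
Proof.
by move=> linF FC; apply: span_linear => // P [p nP Bp]; apply: FC Bp.
Qed.

Lemma nspan_succl (B C : N -> Prop) v : (forall p, B p -> C (nsucc p v)) ->
  forall h, nspan B h -> nspan C (h ≻ b v).
Proof.
move=> BC; apply: nspan_linear => [|P p nP Bp]; first exact: lsucc_linearl.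
exact: nsword_nspan (nsword_succl v nP) (BC _ Bp).
Qed.

Lemma nspan_succr (B C : N -> Prop) v : (forall p, B p -> C (nsucc v p)) ->
  forall h, nspan B h -> nspan C (b v ≻ h).
Proof.
move=> BC; apply: nspan_linear => [|P p nP Bp]; first exact: lsucc_linearr.
exact: nsword_nspan (nsword_succr v nP) (BC _ Bp).
Qed.

(** The outer ≻ signs of v move outwards, (v1 ≻ v2) ≺ P being
v1 ≻ (v2 ≺ P), until the left factor is no ≻-word; what results is a single
normal s-word, over [nprec v p] itself. *)
Lemma nsword_prec_r v P p : nsword P p -> nspan (eq^~ (nprec v p)) (b v ≺ P).
Proof.
move=> nP; elim/nword_ind: v => [v nv|v1 v2 _ IH].
  exact: nsword_nspan (nsword_precr nv nP) _.
rewrite -basis_succ lprec_lsucc nprec_nsucc.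
by apply: nspan_succr IH => q ->.
Qed.

Lemma nspan_precr (B C : N -> Prop) v : (forall p, B p -> C (nprec v p)) ->
  forall h, nspan B h -> nspan C (b v ≺ h).
Proof.
move=> BC; apply: nspan_linear => [|P p nP Bp]; first exact: lprec_linearr.
by apply: nspan_mono (nsword_prec_r v nP) => q ->; apply: BC.
Qed.

Lemma nsword_Id P p : nsword P p -> Id S P.
Proof.
have [_ _ Ip Is] := Id_is_ideal S.
elim=> {P p} [s w Ss _ I _|P p v _ h|v P p _ h|P p v _ _ h|v P p _ _ h].
- by apply.
- by case: (Is _ (b v) h).
- by case: (Is _ (b v) h).
- by case: (Ip _ (b v) h).
- by case: (Ip _ (b v) h).
Qed.

Hypothesis S_monic : forall s, S s -> is_monic s.

Lemma nsword_monic P p : nsword P p -> monic_at P p.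
Proof.
elim=> {P p} [s w Ss ls|P p v _ h|v P p _ h|P p v _ _ h|v P p _ _ h].
- exact: is_monic_at (S_monic Ss) ls.
- apply: (monic_at_linear (lsucc_linearl (b v)) _ (@nsucc_ltl _ _ v) h) => u.
  exact: basis_succ.
- apply: (monic_at_linear (lsucc_linearr (b v)) _ (@nsucc_ltr _ _ v) h) => u.
  exact: basis_succ.
- apply: (monic_at_linear (lprec_linearl (b v)) _ (@nprec_ltl _ _ v) h) => u.
  exact: basis_prec.
- apply: (monic_at_linear (lprec_linearr (b v)) _ (@nprec_ltr _ _ v) h) => u.
  exact: basis_prec.
Qed.

Lemma nspan_supp_in (B : N -> Prop) h :
  (forall p q, B p -> (q <= p)%O -> B q) -> nspan B h -> supp_in B h.
Proof.
move=> downB; elim=> [|a P y [p nP Bp] _ By]; first exact: supp_in0.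
apply: supp_in_lin => //; apply: supp_in_mono (monic_at_le (nsword_monic nP)) => q.
exact: downB.
Qed.

(** * From a Groebner-Shirshov basis to leading words *)

Section Groebner.
Hypothesis S_right : right_mult_trivial S.

(** Right multiplication moves inwards along the outer ≻ signs of the s-word.
If it reaches s, and the leading word of s is a ≻-word, then s ≺ v is a
composition of right multiplication. *)
Lemma nsword_prec_l v P p : nsword P p -> nspan (fun q => q <= nprec p v)%O (P ≺ b v).
Proof.
elim=> {P p} [s w Ss ls|P p u nP _|u P p _ IH|P p u np nP _|u P p nu nP _].
- have [|] := boolP (is_succ w); last first.
    by move=> nw; apply: nsword_nspan (nsword_precl v nw (nsword_gen Ss ls)) _.
  elim/nword_ind: w ls => [w nw _ sw|w1 w2 _ _ ls _]; first by rewrite sw in nw.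
  apply/trivial_belowP; apply: (S_right Ss ls erefl).
  apply: monic_at_lead.
  apply: (monic_at_linear (lprec_linearl (b v)) _ (@nprec_ltl _ _ v)) => [u|].
    exact: basis_prec.
  exact: is_monic_at (S_monic Ss) ls.
- rewrite lprec_lsucc basis_prec nprec_nsucc.
  exact: nsword_nspan (nsword_succl _ nP) _.
- rewrite lprec_lsucc nprec_nsucc; apply: nspan_succr IH => q.
  rewrite le_eqVlt => /orP[/eqP->//|/(nsucc_ltr u)]; exact: ltW.
- apply: nsword_nspan (nsword_precl _ _ (nsword_precl _ np nP)) _ => //.
  by rewrite nprecE.
- apply: nsword_nspan (nsword_precl _ _ (nsword_precr nu nP)) _ => //.
  by rewrite nprecE.
Qed.

Lemma nspan_precl (B C : N -> Prop) v :
  (forall p q, B p -> (q <= nprec p v)%O -> C q) ->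
  forall h, nspan B h -> nspan C (h ≺ b v).
Proof.
move=> BC; apply: nspan_linear => [|P p nP Bp]; first exact: lprec_linearl.
by apply: nspan_mono (nsword_prec_l v nP) => q; apply: BC.
Qed.

(** The closure lemmas multiply by words; an arbitrary factor is a
combination of words. *)
Lemma nspan_is_ideal : is_ideal (nspan (fun=> True)).
Proof.
have extend (F : L -> L) y : linear F ->
    (forall v, nspan (fun=> True) (F (b v))) -> nspan (fun=> True) (F y).
  by move=> linF TF; exact: (supp_in_linear linF (fun v (_ : True) => TF v)).
split=> [|a x y|x y Tx|x y Tx]; [exact: span0 | exact: span_lin | |]; split.
- by apply: (extend (fun z => x ≺ z) y (lprec_linearr x)) => v; apply: nspan_precl Tx.
- by apply: (extend (fun z => z ≺ x) y (lprec_linearl x)) => v; apply: nspan_precr Tx.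
- by apply: (extend (fun z => x ≻ z) y (lsucc_linearr x)) => v; apply: nspan_succl Tx.
- by apply: (extend (fun z => z ≻ x) y (lsucc_linearl x)) => v; apply: nspan_succr Tx.
Qed.

Lemma Id_nspan h : Id S h -> nspan (fun=> True) h.
Proof.
move=> Ih; apply: Ih => [|s Ss]; first exact: nspan_is_ideal.
by have [w ls _] := S_monic Ss; apply: nsword_nspan (nsword_gen Ss ls) _.
Qed.

(** Occurrences in different arguments of a product commute up to lower
terms: P o q - p o Q = (P - p) o Q - P o (Q - q), and P - p, Q - q have only
words below p and q. *)
Lemma cross_nspan (op : L -> L -> L) (r p q : N) P Q :
  (forall y, linear (op^~ y)) -> (forall x, linear (op x)) ->
  nsword P p -> nsword Q q ->
  (forall v, (v < p)%O -> nspan (fun w => (w < r)%O) (op (b v) Q)) ->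
  (forall v, (v < q)%O -> nspan (fun w => (w < r)%O) (op P (b v))) ->
  nspan (fun w => (w < r)%O) (op P (b q) - op (b p) Q).
Proof.
move=> linl linr nP nQ hl hr.
have -> : op P (b q) - op (b p) Q = op (P - b p) Q - op P (Q - b q).
  rewrite (linear_sub _ _ (linl Q)) (linear_sub _ _ (linr P)).
  by rewrite opprB [RHS]addrC addrA subrK.
apply: spanB.
  exact: (supp_in_linear (linl Q) hl (nsword_monic nP)).
exact: (supp_in_linear (linr P) hr (nsword_monic nQ)).
Qed.

Hypothesis S_incl : inclusion_trivial S.

Lemma nsword_incl s P w : S s -> is_lead s w -> nsword P w ->
  nspan (fun v => (v < w)%O) (s - P).
Proof.
move=> Ss ls nP; have [s' [u [Ss' nu ->]]] := nsword_normal_sword nP.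
by apply/trivial_belowP; apply: S_incl.
Qed.

Lemma nspan_oppB B P Q : nspan B (P - Q) -> nspan B (Q - P).
Proof. by rewrite -(opprB P Q); apply: spanN. Qed.

Lemma cross_succ P p Q q : nsword P p -> nsword Q q ->
  nspan (fun w => (w < nsucc p q)%O) (P ≻ b q - b p ≻ Q).
Proof.
move=> nP nQ; apply: cross_nspan => // [||v vp|v vq].
- exact: lsucc_linearl.
- exact: lsucc_linearr.
- exact: nsword_nspan (nsword_succr v nQ) (nsucc_ltl _ vp).
- exact: nsword_nspan (nsword_succl v nP) (nsucc_ltr _ vq).
Qed.

Lemma cross_prec P p Q q : nsword P p -> nsword Q q ->
  nspan (fun w => (w < nprec p q)%O) (P ≺ b q - b p ≺ Q).
Proof.
move=> nP nQ; apply: cross_nspan => // [||v vp|v vq].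
- exact: lprec_linearl.
- exact: lprec_linearr.
- by apply: nspan_mono (nsword_prec_r v nQ) => _ ->; apply: nprec_ltl.
- apply: nspan_mono (nsword_prec_l v nP) => w /le_lt_trans; apply.
  exact: nprec_ltr.
Qed.

(** The two occurrences in the common word p are compared from the root of p.
They go into the same argument of the root, which calls for the induction
hypothesis, or into different ones, which is [cross_succ] or [cross_prec];
when one of them is the whole word, the difference is a composition of
inclusion. *)
Lemma nsword_uniq P Q p :
  nsword P p -> nsword Q p -> nspan (fun w => (w < p)%O) (P - Q).
Proof.
move=> nP; elim: nP Q => {P p}
  [s w Ss ls|P p v nP IH|v P p nP IH|P p v np nP IH|v P p nv nP IH] Q nQ.
- exact: nsword_incl.
- move e: (nsucc p v) nQ => w nQ.
  case: nQ e => {Q w} [s w Ss ls|Q q u nQ|u Q q nQ|Q q u nq nQ|u Q q nu nQ] e.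
  + by apply/nspan_oppB/nsword_incl; rewrite // -e; apply: nsword_succl.
  + have [??] := nsucc_inj e; subst.
    rewrite -(linear_sub _ _ (lsucc_linearl (b u))).
    by apply: nspan_succl (IH _ nQ) => w; apply: nsucc_ltl.
  + by have [??] := nsucc_inj e; subst; apply: cross_succ.
  + by case: (nsucc_neq_nprec nq e).
  + by case: (nsucc_neq_nprec nu e).
- move e: (nsucc v p) nQ => w nQ.
  case: nQ e => {Q w} [s w Ss ls|Q q u nQ|u Q q nQ|Q q u nq nQ|u Q q nu nQ] e.
  + by apply/nspan_oppB/nsword_incl; rewrite // -e; apply: nsword_succr.
  + by have [??] := nsucc_inj e; subst; apply/nspan_oppB/cross_succ.
  + have [??] := nsucc_inj e; subst.
    rewrite -(linear_sub _ _ (lsucc_linearr (b u))).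
    by apply: nspan_succr (IH _ nQ) => w; apply: nsucc_ltr.
  + by case: (nsucc_neq_nprec nq e).
  + by case: (nsucc_neq_nprec nu e).
- move e: (nprec p v) nQ => w nQ.
  case: nQ e => {Q w} [s w Ss ls|Q q u nQ|u Q q nQ|Q q u nq nQ|u Q q nu nQ] e.
  + by apply/nspan_oppB/nsword_incl; rewrite // -e; apply: nsword_precl.
  + by case: (nsucc_neq_nprec np (esym e)).
  + by case: (nsucc_neq_nprec np (esym e)).
  + have [??] := nprec_inj np nq e; subst.
    rewrite -(linear_sub _ _ (lprec_linearl (b u))).
    by apply: nspan_precl (IH _ nQ) => w w' /(nprec_ltl u) h /le_lt_trans; apply.
  + by have [??] := nprec_inj np nu e; subst; apply: cross_prec.
- move e: (nprec v p) nQ => w nQ.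
  case: nQ e => {Q w} [s w Ss ls|Q q u nQ|u Q q nQ|Q q u nq nQ|u Q q nu nQ] e.
  + by apply/nspan_oppB/nsword_incl; rewrite // -e; apply: nsword_precr.
  + by case: (nsucc_neq_nprec nv (esym e)).
  + by case: (nsucc_neq_nprec nv (esym e)).
  + by have [??] := nprec_inj nv nq e; subst; apply/nspan_oppB/cross_prec.
  + have [??] := nprec_inj nv nu e; subst.
    rewrite -(linear_sub _ _ (lprec_linearr (b u))).
    by apply: nspan_precr (IH _ nQ) => w; apply: nprec_ltr.
Qed.

(** A finite sum has a largest leading word, so that a strict bound can be
replaced by an attained one; this is what makes the descent of [nspan_lead]
proceed. *)
Lemma nspan_bounded (B : N -> Prop) h : nspan B h ->
  h = 0 \/ exists2 w, B w & nspan (fun v => (v <= w)%O) h.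
Proof.
elim=> [|a P y [p nP Bp] _ IH]; [by left | right].
have aP : nspan (fun v => (v <= p)%O) (a *: P) by apply/spanZ/(nsword_nspan nP).
case: IH => [->|[w Bw Ty]]; first by exists p; rewrite ?addr0.
exists (Order.max p w); first by rewrite /Order.max; case: ifP.
by apply: spanD; [apply: nspan_mono aP | apply: nspan_mono Ty] => v; 
  rewrite le_max => ->; rewrite ?orbT.
Qed.

(** Several normal s-words over w collapse into a multiple of one of them, by
[nsword_uniq]. *)
Lemma nspan_top w h : nspan (fun v => (v <= w)%O) h ->
  nspan (fun v => (v < w)%O) h \/
  exists P a, nsword P w /\ nspan (fun v => (v < w)%O) (h - a *: P).
Proof.
elim=> [|a P y [p nP]]; first by left; apply: span0.
rewrite le_eqVlt => /orP[/eqP ep|lt_pw] _ [IH|[Q [c [nQ IH]]]].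
- right; exists P, a; rewrite -[in nsword _ _]ep; split=> //.
  by rewrite addrAC subrr add0r.
- rewrite ep in nP.
  right; exists Q, (a + c).
  split; first exact: nQ.
  have -> : a *: P + y - (a + c) *: Q = a *: (P - Q) + (y - c *: Q).
    by rewrite scalerDl scalerBr opprD addrACA.
  exact: span_lin (nsword_uniq nP nQ) IH.
- by left; apply: span_add => //; exists p.
- by right; exists Q, c; split=> //; rewrite -addrA; apply: span_add => //; exists p.
Qed.

(** Only one s-word over w is left by [nspan_top].  If its coefficient
vanishes, then h is a combination of normal s-words below w and the induction
proceeds; otherwise nothing can cancel w. *)
Lemma nspan_lead : well_founded (fun p q : N => (p < q)%O) ->
  forall h, h <> 0 -> nspan (fun=> True) h ->
  exists w P, is_lead h w /\ nsword P w.
Proof.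
move=> wf h h0 /nspan_bounded[//|[w _]]; elim: w / (wf w) h h0 => w _ IH h h0 Th.
have lower h' : h' <> 0 -> nspan (fun v => (v < w)%O) h' ->
    exists w P, is_lead h' w /\ nsword P w.
  by move=> h'0 /nspan_bounded[//|[w' lt_w Th']]; apply: (IH w').
have [Tlt|[P [a [nP Tlt]]]] := nspan_top Th; first exact: lower.
have [a0|a0] := eqVneq a 0.
  by apply: lower => //; rewrite a0 scale0r subr0 in Tlt.
exists w, P; split=> //; split; last first.
  by apply: nspan_supp_in Th => p q + qp; apply: le_trans.
have /mcoeff_supp_in -/(_ w) : supp_in (fun v => (v < w)%O) (h - a *: P).
  by apply: nspan_supp_in Tlt => p q + qp; apply: le_lt_trans.
rewrite ltxx mcoeffB mcoeffZ (monic_at_mcoeff (nsword_monic nP)) mulr1.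
move=> /(_ _)/eqP; rewrite subr_eq0 -mcoeff_neq0 => h_eq.
by rewrite (eqP (h_eq _)).
Qed.

End Groebner.

(** * Reduction modulo the ideal *)

Hypothesis wfN : well_founded (fun p q : N => (p < q)%O).

Lemma Id_lin a f g : Id S f -> Id S g -> Id S (a *: f + g).
Proof. by have [_ h _ _] := Id_is_ideal S; apply: h. Qed.

Lemma Id_subZ f a P : Id S f -> Id S P -> Id S (f - a *: P).
Proof. by move=> If IP; rewrite addrC -scaleNr; apply: Id_lin. Qed.

Definition leads_reducible := forall f, f <> 0 -> Id S f ->
  exists w P, is_lead f w /\ nsword P w.

(** Repeated cancellation of the leading word by a normal s-word, which stays
inside the ideal and lowers the leading word. *)
Lemma leads_reducible_nspan : leads_reducible ->
  forall f w, Id S f -> is_lead f w -> nspan (fun v => (v <= w)%O) f.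
Proof.
move=> red f w; elim: w / (wfN w) f => w _ IH f If lf.
have [w' [P [lf' nP]]] := red f (is_lead_neq0 lf) If.
rewrite -(is_lead_uniq lf lf') {w' lf'} in nP.
rewrite -[f](subrK (f@_w *: P)); apply: spanD; last by apply/spanZ/(nsword_nspan nP).
have lt_g := lead_cancel lf.2 (nsword_monic nP).
have Ig : Id S (f - f@_w *: P) by apply: Id_subZ => //; apply: nsword_Id nP.
move: (f - _) lt_g Ig => g lt_g Ig.
have [->|/eqP/is_lead_exists[w' lg]] := eqVneq g 0; first exact: span0.
have lt_w := lt_g _ lg.1.
apply: nspan_mono (IH w' lt_w g Ig lg) => v /le_lt_trans/(_ lt_w); exact: ltW.
Qed.

Lemma leads_reducible_GS : leads_reducible -> GS_basis S.
Proof.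
move=> red; split=> [f fbar _ _ v Sf _ _ w lw|f g u w Sf Sg lf nu].
  apply/trivial_belowP; apply: leads_reducible_nspan => //.
  have [_ _ Ip _] := Id_is_ideal S.
  by have [] := Ip f (b v) (fun I _ SI => SI f Sf).
apply/trivial_belowP; have nQ := normal_sword_nsword Sg nu.
have mf := nsword_monic (nsword_gen Sf lf).
have := lead_cancel lf.2 (nsword_monic nQ).
rewrite (monic_at_mcoeff mf) scale1r.
have : Id S (f - star_eval u g).
  rewrite -[star_eval u g]scale1r; apply: Id_subZ; last exact: nsword_Id nQ.
  exact: nsword_Id (nsword_gen Sf lf).
move: (f - _) => h Ih lt_h.
have [->|/eqP/is_lead_exists[w' lh]] := eqVneq h 0; first exact: span0.
apply: nspan_mono (leads_reducible_nspan red Ih lh) => v /le_lt_trans; apply.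
exact: lt_h lh.1.
Qed.

Lemma IrrP p : Irr S p <-> ~ exists P, nsword P p.
Proof.
split=> [irr [P /nsword_normal_sword[s [u [Ss nu _]]]]|nred s u Ss nu].
  exact: irr nu.
by apply: nred; exists (star_eval u s); apply: normal_sword_nsword.
Qed.

(** Having an irreducible remainder is a linear property. *)
Lemma Irr_division_span (B : N -> Prop) f :
  span (fun x : L => exists2 g, supp_in (fun v => B v /\ Irr S v) g & Id S (x - g)) f ->
  exists2 g, supp_in (fun v => B v /\ Irr S v) g & Id S (f - g).
Proof.
elim=> [|a x y [g gI Ig] _ [g' gI' Ig']].
  by exists 0; [exact: supp_in0 | rewrite subr0; have [] := Id_is_ideal S].
exists (a *: g + g'); first exact: supp_in_lin.
by rewrite opprD addrACA -scalerBr; apply: Id_lin.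
Qed.

(** If w is the leading word of a normal s-word P, then w is congruent to
w - P, whose words are lower. *)
Lemma Irr_division_word w : exists2 g,
  supp_in (fun v => (v <= w)%O /\ Irr S v) g & Id S (b w - g).
Proof.
elim: w / (wfN w) => w _ IH.
have [irr|/IrrP/boolp.contrapT[P nP]] := boolp.pselect (Irr S w).
  exists (b w); first exact: supp_in_basis.
  by rewrite subrr; have [] := Id_is_ideal S.
have [|g gI Ig] := @Irr_division_span (fun v => v <= w)%O (b w - P).
  have lt_w : supp_in (fun v => (v < w)%O) (P - b w) by apply: nsword_monic.
  rewrite -opprB; apply/spanN.
  apply: (supp_in_linear (F := idfun) _ _ lt_w) => [//|v vw].
  apply: span_gen; have [g gI Ig] := IH v vw; exists g => //.
  apply: supp_in_mono gI => q [qv irr]; split=> //.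
  exact: le_trans qv (ltW vw).
exists g => //.
have -> : b w - g = 1 *: P + (b w - P - g).
  by rewrite scale1r [RHS]addrC addrAC subrK.
exact: Id_lin (nsword_Id nP) Ig.
Qed.

(** The bound B is kept so that the remainder of the lower part of an element
cannot reach its leading word. *)
Lemma Irr_division (B : N -> Prop) f :
  (forall p q, B p -> (q <= p)%O -> B q) -> supp_in B f ->
  exists2 g, supp_in (fun v => B v /\ Irr S v) g & Id S (f - g).
Proof.
move=> downB Bf; apply: Irr_division_span.
apply: (supp_in_linear (F := idfun) _ _ Bf) => [//|v Bv].
apply: span_gen; have [g gI Ig] := Irr_division_word v; exists g => //.
by apply: supp_in_mono gI => q [qv irr]; split=> //; apply: downB qv.
Qed.

(** A linear relation between irreducible words is an element of the ideal
with irreducible words only, against (II). *)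
Lemma reducible_basis : leads_reducible ->
  is_basis_on (V := ell_quot S) (Irr S) (fun u : N => ell_pi S (b u)).
Proof.
move=> red; split=> [n t c inj_t irr_t sum0 i|x].
  pose f : L := \sum_(i < n) c i *: b (t i).
  have If : Id S f.
    rewrite -[f]subr0; apply/(ell_pi_eq S).
    rewrite !linear_sum linear0 -[RHS]sum0; apply: eq_bigr => j _.
    by rewrite linearZ.
  have f_t j : f@_(t j) = c j.
    rewrite /f raddf_sum (bigD1 j) //= big1 => [|l lj].
      by rewrite mcoeffZ mcoeffUU mulr1 addr0.
    rewrite mcoeffZ mcoeffU (inj_eq inj_t) (negbTE lj) mulr0n mulr0.
    by [].
  have f_irr : supp_in (Irr S) f.
    apply: span_supp_in; apply: span_sum => j; exact: supp_in_basis.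
  have [f0|/eqP f0] := eqVneq f 0; first by rewrite -f_t f0 mcoeff0.
  have [w [P [lw nP]]] := red f f0 If.
  by have /IrrP[] := f_irr w lw.1; exists P.
have [g gI Ig] := @Irr_division (fun=> True) (ell_repr x)
  (fun _ _ _ _ => I) (fun _ _ => I).
pose s := enum_fset (msupp g).
exists (size s), (tnth (in_tuple s)), (fun i => g@_(tnth (in_tuple s) i)).
split=> [i|]; first by case: (gI (tnth (in_tuple s) i)) => //; apply: mem_tnth.
rewrite -[LHS]ell_reprK (_ : ell_pi S _ = ell_pi S g); last exact/ell_pi_eq.
rewrite [LHS](f_equal _ (malg_sum_tnth g)) linear_sum; apply: eq_bigr => i _.
by rewrite linearZ.
Qed.

(** If w, leading in f, were irreducible, reducing the rest of f would give
a relation f_w w + g between irreducible words in the quotient. *)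
Lemma basis_reducible :
  is_basis_on (V := ell_quot S) (Irr S) (fun u : N => ell_pi S (b u)) ->
  leads_reducible.
Proof.
move=> [free _] f f0 If; have [w lw] := is_lead_exists f0.
exists w; apply: boolp.contrapT => nred.
have irr : Irr S w by apply/IrrP => -[P nP]; apply: nred; exists P.
have [g gI Ig] := @Irr_division (fun v => v < w)%O (f - f@_w *: b w)
  (fun _ _ pw qp => le_lt_trans qp pw) (lead_cancel lw.2 (@monic_at_basis k d X w)).
pose h := f@_w *: b w + g.
have Ih : Id S h.
  have -> : h = f - 1 *: (f - f@_w *: b w - g).
    by rewrite scale1r !opprD !opprK !addrA subrr add0r.
  exact: Id_subZ.
have hI : supp_in (Irr S) h.
  apply: supp_in_lin; first exact: supp_in_basis.
  by apply: supp_in_mono gI => v [].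
have h_w : h@_w = f@_w.
  rewrite mcoeffD mcoeffZ mcoeffUU mulr1 (mcoeff_supp_in gI) ?addr0 //.
  by rewrite ltxx => -[].
have wh : w \in msupp h by rewrite -mcoeff_neq0 h_w mcoeff_neq0; exact: lw.1.
pose s := enum_fset (msupp h).
have ws : (index w s < size s)%N by rewrite index_mem.
have inj_s : injective (tnth (in_tuple s)) by apply/tuple_uniqP/fset_uniq.
have irr_s i : Irr S (tnth (in_tuple s) i) by apply/hI/mem_tnth.
have h0 : h@_(tnth (in_tuple s) (Ordinal ws)) = 0.
  apply: (free _ _ (fun i => h@_(tnth (in_tuple s) i)) inj_s irr_s).
  have pi_h : ell_pi S h = 0.
    by rewrite -(linear0 (ell_pi S)); apply/ell_pi_eq; rewrite subr0.
  apply: etrans pi_h; rewrite [RHS](f_equal _ (malg_sum_tnth h)) linear_sum.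
  by apply: eq_bigr => i _; rewrite linearZ.
by move/eqP: h0; rewrite (tnth_nth w) /= nth_index // mcoeff_eq0 wh.
Qed.

End StarWords.

Theorem theorem4p6 (k : fieldType) (d : Order.disp_t) (X : orderType d)
    (X_wo : well_founded (fun x y : X => (x < y)%O))
    (S : freeL k X -> Prop) (S_monic : forall s, S s -> is_monic s) :
  let stmt1 := GS_basis S in
  let stmt2 := forall f : freeL k X, f <> 0 -> Id S f ->
    exists (fbar : nword X) (s : freeL k X) (u : word (option X)),
      [/\ is_lead f fbar, S s & normal_sword u s fbar] in
  let stmt3 := is_basis_on (V := ell_quot S) (Irr S)
    (fun u : nword X => ell_pi S (basis_elt k u)) in
  (stmt1 <-> stmt2) /\ (stmt2 <-> stmt3).
Proof.
move=> stmt1 stmt2 stmt3.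
have wf := nword_wf X_wo.
have red2 : stmt2 <-> leads_reducible S.
  split=> red f f0 /(red f f0).
    move=> [w [s [u [lw Ss nu]]]]; exists w, (star_eval u s); split=> //.
    exact: normal_sword_nsword nu.
  move=> [w [P [lw /nsword_normal_sword[s [u [Ss nu _]]]]]].
  by exists w, s, u.
split; split.
- move=> [S_right S_incl]; apply/red2 => f f0 /(Id_nspan S_monic S_right).
  exact: nspan_lead.
- by move=> /red2; apply: leads_reducible_GS.
- by move=> /red2; apply: reducible_basis.
- by move=> /(basis_reducible S_monic wf)/red2.
Qed.
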